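(* Let $n$ be even and $m,n\ge 4$. Then \[ W(C_{m,n})=\tfrac{1}{12}\big(2m^3n^3+2m^3n^2+2m^3n+4m^3+4m^2n^3-3m^2n^2-m^2n-6m^2-2mn^3+4mn^2-2mn-16m+24n^2-72n+72+\beta\big), \] where $\beta=3n-6$ if $m$ is odd and $\beta=0$ if $m$ is even.
   Context: For a digraph $D$, $d_D(u,v)$ is the length of a shortest directed path from $u$ to $v$, and $d_D(u,v)=0$ if there is no such path. The Wiener index is $W(D)=\sum_{(u,v)\in V(D)\times V(D)} d_D(u,v)$, the sum over all ordered pairs. The grid $G_{m,n}=P_m\Box P_n$ has vertices $(i,j)$, $1\le i\le m$ (row, row $1$ being the top row), $1\le j\le n$ (column), with $(i,j)$ adjacent to $(i\pm1,j)$ and $(i,j\pm1)$. For $m\ge 3$ and even $n\ge 4$, the comb orientation $C_{m,n}$ of $G_{m,n}$ is defined as follows. First orient the edges of the following Hamiltonian cycle $C$ along the cycle: row $1$ from $(1,1)$ to $(1,n)$ (arcs $(1,j)\to(1,j+1)$); column $n$ downward from $(1,n)$ to $(m,n)$; then for each even $j$ with $2\le j\le n$ the arc $(m,j)\to(m,j-1)$; for each odd $j$ with $3\le j\le n-1$ the column $j$ is traversed upward from $(m,j)$ to $(2,j)$ and followed by the arc $(2,j)\to(2,j-1)$; for each even $j$ with $2\le j\le n-2$ the column $j$ is traversed downward from $(2,j)$ to $(m,j)$; finally column $1$ is traversed upward from $(m,1)$ to $(1,1)$. (Thus the cycle is $(1,1),\dots,(1,n),(2,n),\dots,(m,n),(m,n-1),\dots,(2,n-1),(2,n-2),\dots,(m,n-2),(m,n-3),\dots,(2,2),\dots,(m,2),(m,1),(m-1,1),\dots,(1,1)$.)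 All remaining edges are oriented as follows: every remaining horizontal edge $\{(i,j),(i,j+1)\}$ with $2\le i\le m$ is oriented $(i,j)\to(i,j+1)$, and every remaining vertical edge $\{(1,j),(2,j)\}$, $2\le j\le n-1$, is oriented $(2,j)\to(1,j)$. *)

(* Defs.v *)
From mathcomp Require Import all_boot all_order all_algebra.

Set Implicit Arguments.
Unset Strict Implicit.
Unset Printing Implicit Defensive.

(* A digraph is given by its arc relation [e] on a finite type of vertices. *)
Section Digraph.

Variables (T : finType) (e : rel T).

Definition has_dipath (u v : T) (k : nat) : bool :=
  [exists p : k.-tuple T,
     [&& path e u p, uniq (u :: p) & last u p == v]].

Lemma has_dipath_ex (u v : T) : connect e u v -> exists k, has_dipath u v k.
Proof.
move=> /connectP [p pth ->]; case: (shortenP pth) => q qth uq _.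
by exists (size q); apply/existsP; exists (in_tuple q); rewrite qth uq eqxx.
Qed.

Definition ddist (u v : T) : nat :=
  if @idP (connect e u v) is ReflectT uv then ex_minn (has_dipath_ex uv) else 0.

Definition wiener : nat := \sum_(p : T * T) ddist p.1 p.2.

End Digraph.

Section Comb.

Variables m n : nat.

Definition vertex : finType := ('I_m * 'I_n)%type.

(* Ordinals start at 0; [row] and [col] are the 1-based coordinates. *)
Definition row (u : vertex) : nat := u.1.+1.
Definition col (u : vertex) : nat := u.2.+1.

Definition hedge (u v : vertex) : bool :=
  (row u == row v) && ((col v == (col u).+1) || (col u == (col v).+1)).

Definition vedge (u v : vertex) : bool :=
  (col u == col v) && ((row v == (row u).+1) || (row u == (row v).+1)).

(* For even n, the arcs of the directed Hamiltonian cycle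
     (1,1), ..., (1,n), (2,n), ..., (m,n), (m,n-1), ..., (2,n-1),
     (2,n-2), ..., (m,n-2), (m,n-3), ..., (2,2), ..., (m,2),
     (m,1), ..., (1,1):
   it goes up the odd columns and down the even ones, and the columns
   other than 1 and n are only traversed between rows 2 and m. *)
Definition cycle_arc (u v : vertex) : bool :=
  let i := row u in let j := col u in
  let i' := row v in let j' := col v in
  [|| [&& i == 1, i' == 1 & j' == j.+1],
      [&& j == n, j' == n & i' == i.+1],
      [&& i == m, i' == m, ~~ odd j, 2 <= j <= n & j == j'.+1],
      [&& odd j, 3 <= j <= n.-1, j' == j, i == i'.+1 & 2 <= i'],
      [&& odd j, 3 <= j <= n.-1, i == 2, i' == 2 & j == j'.+1],
      [&& ~~ odd j, 2 <= j <= n - 2, j' == j, 2 <= i & i' == i.+1]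
    | [&& j == 1, j' == 1 & i == i'.+1]].

(* Meant for the edges {u, v} of the grid: those not on the cycle. *)
Definition remaining (u v : vertex) : bool :=
  ~~ cycle_arc u v && ~~ cycle_arc v u.

Definition comb : rel vertex := fun u v =>
  [|| cycle_arc u v,
      [&& hedge u v, remaining u v, 2 <= row u <= m & col v == (col u).+1]
    | [&& vedge u v, remaining u v, 2 <= col u <= n.-1,
          row u == 2 & row v == 1]].

End Comb.

(* Main.v *)
(* Distances in the comb orientation are explicit.  Moving right is cheap: apart
   from a detour of 2 when source and target lie on a common interrupted row,
   the grid distance is achieved.  Moving left is only possible along the
   Hamiltonian cycle, which traverses every intermediate column completely.
   An upper row vertex reaches lower rows only through the last column.  A
   function on pairs is the distance of a digraph as soon as it vanishes on the
   diagonal, drops by at most one along arcs, and drops by exactly one along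
   some arc; this is checked arc by arc.  The formula is then summed over each
   pair of columns and finally over all pairs of columns.  The dependence on
   the parity of m comes from a backward move inside an inner column, which can
   turn around through either neighbouring column: its cost is a minimum of two
   linear functions. *)

Require Import Defs.
From mathcomp Require Import all_boot all_order all_algebra.
From mathcomp Require Import zify ring.

(** * Distances in an arbitrary digraph *)

Lemma ddist_potential (T : finType) (e : rel T) (f : T -> T -> nat) :
    (forall v, f v v = 0) ->
    (forall u w v, e u w -> f u v <= (f w v).+1) ->
    (forall u v, u != v -> exists2 w, e u w & f u v = (f w v).+1) ->
  forall u v, ddist e u v = f u v.
Proof.
move=> f0 fle fstep u v.
have lower p x : path e x p -> f x (last x p) <= size p.
  elim: p x => [|y p IHp] x /=; first by rewrite f0.
  by case/andP=> /fle fxy /IHp ?; apply: leq_trans (fxy _) _.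
have upper k x : f x v = k -> exists p, [/\ path e x p, last x p = v & size p = k].
  elim: k x => [|k IHk] x fx.
    have [->|/fstep[w _]] := eqVneq x v; first by exists [::].
    by rewrite fx.
  have [xv|/fstep[w exw]] := eqVneq x v; first by rewrite xv f0 in fx.
  rewrite fx => -[/esym/IHk[p [pw lw sp]]].
  by exists (w :: p); rewrite /= exw pw lw sp.
have [p [pu lu sp]] := upper _ u erefl.
have uv : connect e u v by apply/connectP; exists p.
rewrite /ddist; case: {-}_ / idP => [uv'|/(_ uv)//].
case: ex_minnP => k /existsP[q /and3P[qu _ /eqP lq]] kmin.
have := lower _ _ qu; rewrite lq size_tuple => fk.
apply/eqP; rewrite eqn_leq fk andbT -sp.
(* [has_dipath] asks for a simple path, while the walk [p] obtained by descent is not known to be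
   one. Shortening keeps its length at most [size p]. *)
case: (shortenP pu) lu => q' q'u uq' sub lq'.
have : has_dipath e u v (size q').
  by apply/existsP; exists (in_tuple q'); rewrite q'u uq' lq' eqxx.
move/kmin => /leq_trans; apply; apply: uniq_leq_size => //.
by case/andP: uq'.
Qed.

(** * Arcs and candidate distances in coordinates *)

(* Coordinates are 0-based from here on: row 0 is the top row, and the columns
   pointing down are those of odd index. *)
Definition comb_arc m n i j i' j' : bool :=
  [|| [&& i' == i, j' == j.+1 &
        (i == 0) || (if odd j then i != 1 else i != m.-1)],
      [&& i' == i, j == j'.+1 & if odd j then i == m.-1 else i == 1],
      [&& j' == j, i == i'.+1, j < n.-1 & ~~ odd j || (i == 1)]
    | [&& j' == j, i' == i.+1, odd j & (0 < i) || (j == n.-1)]].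

Lemma combE m n (u v : vertex m n) : 3 < m -> 3 < n -> ~~ odd n ->
  comb u v = comb_arc m n u.1 u.2 v.1 v.2.
Proof.
move=> hm hn nev; case: u v => [[i im] [j jn]] [[i' im'] [j' jn']].
rewrite /comb /remaining /cycle_arc /hedge /vedge /Defs.row /Defs.col /comb_arc /=.
rewrite !eqSS !ltnS !negbK.
have F (k : nat) : ((k == k.+1 = false) * (k.+1 == k = false) *
    (k == k.+2 = false) * (k.+2 == k = false))%type by do !split; lia.
have [e|nj1] := eqVneq j' j.+1.
  rewrite e !F in jn' *; have [->|ni] := eqVneq i' i.
    by rewrite ?F; case oj: (odd j); rewrite /= ?andbF ?andbT; lia.
  by rewrite ?andbF; lia.
have [e|nj2] := eqVneq j j'.+1.
  rewrite e !F /= in jn nj1 *; have [->|ni] := eqVneq i' i.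
    by rewrite ?F; case oj: (odd j'); rewrite /= ?andbF ?andbT; lia.
  by rewrite ?andbF; lia.
have [->|nj3] := eqVneq j' j; last by rewrite ?(andbF, orbF); lia.
rewrite ?F ?andbF.
have [e|ni1] := eqVneq i' i.+1.
  by rewrite e ?F; case oj: (odd j); rewrite /= ?andbF ?andbT; lia.
have [e|ni2] := eqVneq i i'.+1; last by rewrite ?(andbF, orbF) /=; lia.
by rewrite e ?F; case oj: (odd j); rewrite /= ?andbF ?andbT; lia.
Qed.

(* Leftward distance for j' < j and i, i' > 0: leave column j at its exit, run
   through the columns strictly between, then reach row i' from the entry of
   column j'. *)
Definition snake_dist (m i j i' j' : nat) : nat :=
  (if odd j then m.-1 - i else i.-1) + 1 + (j - j').-1 * m.-1
  + (if odd j' then i'.-1 else m.-1 - i').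

(* Whether the row i is interrupted between the columns j < j'; rows m - 1 and
   1 lack the rightward arcs leaving even and odd columns respectively. *)
Definition blocked (m i j j' : nat) : bool :=
  (i == m.-1) && (~~ odd j || (j.+1 < j')) || (i == 1) && (odd j || (j.+1 < j')).

(* Both rows positive.  A backward move inside a column turns around at the top
   through one neighbouring column (cost i + i') or at the bottom through the
   other one (cost 2 m - i - i'); the first and last columns have only the
   latter. *)
Definition lower_dist (m n i j i' j' : nat) : nat :=
  if j' < j then snake_dist m i j i' j'
  else if j < j' then (j' - j) + ((i - i') + (i' - i))
    + (if (i == i') && blocked m i j j' then 2 else 0)
  else if (if odd j then i <= i' else i' <= i) then (i - i') + (i' - i)
  else if (j == 0) || (j == n.-1) then 2 * m - i - i'
  else minn (i + i') (2 * m - i - i').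

(* From row i > 0 to the top row. *)
Definition rise_dist (m n i j j' : nat) : nat :=
  if j < j' then i + (j' - j)
  else if j' < j then (snake_dist m i j 1 j').+1
  else if ~~ odd j then i
  else if j == n.-1 then 2 * m - i
  else if i == 1 then 1 else i.+2.

(** The top row is left only at its right end, and [n - j] is the length of the walk from [(0, j)]
    to [(1, n.-1)]. The successor after [snake_dist] is the final arc from [(1, j')] up to the top
    row. *)
Definition comb_dist (m n i j i' j' : nat) : nat :=
  if i == 0 then
    if i' == 0 then
      if j <= j' then j' - j else (n - j) + (snake_dist m 1 n.-1 1 j').+1
    else (n - j) + lower_dist m n 1 n.-1 i' j'
  else if i' == 0 then rise_dist m n i j j'
  else lower_dist m n i j i' j'.

Ltac case_ifs := repeat match goal with |- context [if ?b then _ else _] =>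
   lazymatch b with
   | context [if _ then _ else _] => fail
   | _ => let H := fresh "C" in case H: b; try (exfalso; lia)
   end end.

Lemma odd_last n : 3 < n -> ~~ odd n -> odd n.-1.
Proof. by lia. Qed.

(** * Verification that the candidate is the distance *)

Section Distance.
Variables m n : nat.
Hypotheses (hm : 3 < m) (hn : 3 < n) (nev : ~~ odd n).

(** Both distances share the nonlinear term [t], which [lia] can then treat as an atom when
    comparing neighbouring columns. *)
Lemma snake_distS i k j i' j' (t := (j - j').-1 * m.-1) : j' < j ->
  (snake_dist m i j i' j' =
     (if odd j then m.-1 - i else i.-1) + 1 + t
     + (if odd j' then i'.-1 else m.-1 - i'))
  * (snake_dist m k j.+1 i' j' =
     (if odd j then k.-1 else m.-1 - k) + 1 + (m.-1 + t)
     + (if odd j' then i'.-1 else m.-1 - i')).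
Proof.
move=> lt; rewrite /snake_dist subSn 1?ltnW //=; split=> //.
rewrite -mulSn (ltn_predK (m := 0)) ?subn_gt0 //.
by case: (odd j).
Qed.

Lemma snake_dist_next i j i' :
  snake_dist m i j.+1 i' j = (if odd j then i.-1 else m.-1 - i) + 1
                             + (if odd j then i'.-1 else m.-1 - i').
Proof. by rewrite /snake_dist subSnn mul0n addn0 /= if_neg; case: (odd j). Qed.

(** The exit row of column [j] is the entry row of column [j.-1], so only the connecting arc is
    paid. *)
Lemma snake_dist_turn (i j i' j' : nat) :
  j' < j.-1 -> i = (if odd j then m.-1 else 1) -> i < m ->
  snake_dist m i j i' j' = (snake_dist m i j.-1 i' j').+1.
Proof.
move=> lt ei im; have [] := snake_distS i i j.-1 i' j' lt; rewrite prednK; last by lia.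
move=> -> ->; have oj : odd j = ~~ odd j.-1 by lia.
by move: ei; rewrite oj; case: (odd j.-1) => /= *; lia.
Qed.

Lemma lower_dist_lip (i j k l i' j' : nat) :
  0 < i < m -> 0 < k < m -> 0 < i' < m -> j < n -> l < n -> j' < n ->
  comb_arc m n i j k l -> lower_dist m n i j i' j' <= (lower_dist m n k l i' j').+1.
Proof.
move=> im km im' jn ln jn'.
(* Arcs pointing right, left, up and down, in this order; each is split by the position of the
   target column. *)
case/or4P=> /and3P[/eqP e1 /eqP e2 a]; subst.
- rewrite /lower_dist /blocked /= in a *.
  case: (ltngtP j j') => [lt|lt|e].
  + case oj: (odd j) a => /= a; case_ifs; lia.
  + by rewrite !(snake_distS i i _ _ _ lt);
      case oj: (odd j) a => /= a; case_ifs; lia.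
  + subst j'; rewrite snake_dist_next; case oj: (odd j) a => /= a; case_ifs; lia.
- rewrite /lower_dist /blocked /= in a *.
  case: (ltngtP l j') => [lt|lt|e].
  + case oj: (odd l) a => /= a; case_ifs; lia.
  + by rewrite !(snake_distS i i _ _ _ lt);
      case oj: (odd l) a => /= a; case_ifs; lia.
  + subst j'; rewrite snake_dist_next; case oj: (odd l) a => /= a; case_ifs; lia.
- rewrite /lower_dist /blocked /= in a *.
  case: (ltngtP j j') => [lt|lt|e].
  + by case oj: (odd j) a => /= a; case_ifs; lia.
  (* A vertical arc stays in column [j], so the first equation suffices and [0] is a dummy row. *)
  + by rewrite !(fst (snake_distS _ 0 _ _ _ lt));
      case oj: (odd j) a => /= a; case_ifs; lia.
  + subst j'; case oj: (odd j) a => /= a; case_ifs; lia.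
- rewrite /lower_dist /blocked /= in a *.
  case: (ltngtP j j') => [lt|lt|e].
  + by case oj: (odd j) a => /= a; case_ifs; lia.
  + by rewrite !(fst (snake_distS _ 0 _ _ _ lt));
      case oj: (odd j) a => /= a; case_ifs; lia.
  + subst j'; case oj: (odd j) a => /= a; case_ifs; lia.
Qed.

Lemma rise_dist_lip (i j k l j' : nat) :
  0 < i < m -> 0 < k < m -> j < n -> l < n -> j' < n ->
  comb_arc m n i j k l -> rise_dist m n i j j' <= (rise_dist m n k l j').+1.
Proof.
move=> im km jn ln jn'.
case/or4P=> /and3P[/eqP e1 /eqP e2 a]; subst.
- rewrite /rise_dist /= in a *.
  case: (ltngtP j j') => [lt|lt|e].
  + case oj: (odd j) a => /= a; case_ifs; lia.
  + by rewrite !(snake_distS i i _ _ _ lt);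
      case oj: (odd j) a => /= a; case_ifs; lia.
  + subst j'; rewrite snake_dist_next; case oj: (odd j) a => /= a; case_ifs; lia.
- rewrite /rise_dist /= in a *.
  case: (ltngtP l j') => [lt|lt|e].
  + case oj: (odd l) a => /= a; case_ifs; lia.
  + by rewrite !(snake_distS i i _ _ _ lt);
      case oj: (odd l) a => /= a; case_ifs; lia.
  + subst j'; rewrite snake_dist_next; case oj: (odd l) a => /= a; case_ifs; lia.
- rewrite /rise_dist /= in a *.
  case: (ltngtP j j') => [lt|lt|e].
  + by case oj: (odd j) a => /= a; case_ifs; lia.
  + by rewrite !(fst (snake_distS _ 0 _ _ _ lt));
      case oj: (odd j) a => /= a; case_ifs; lia.
  + subst j'; case oj: (odd j) a => /= a; case_ifs; lia.
- rewrite /rise_dist /= in a *.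
  case: (ltngtP j j') => [lt|lt|e].
  + by case oj: (odd j) a => /= a; case_ifs; lia.
  + by rewrite !(fst (snake_distS _ 0 _ _ _ lt));
      case oj: (odd j) a => /= a; case_ifs; lia.
  + subst j'; case oj: (odd j) a => /= a; case_ifs; lia.
Qed.
(** Needed for arcs climbing to the top row: restarting from the last column crosses more columns
    and pays a full exit. *)
Lemma snake_dist_last (j i' j' : nat) : j' < j < n.-1 ->
  snake_dist m 1 j i' j' <= snake_dist m 1 n.-1 i' j'.
Proof.
move=> lt; rewrite /snake_dist (odd_last n hn nev) leq_add2r; apply: leq_add.
  by case: ifP; lia.
by rewrite leq_mul2r; apply/orP; right; lia.
Qed.

(** This is the bound along the arc from [(1, j)] up to [(0, j)], for targets below the top row. *)
Lemma lower_dist_top (j i' j' : nat) : 0 < i' < m -> j < n.-1 -> j' < n ->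
  lower_dist m n 1 j i' j' <= (n - j + lower_dist m n 1 n.-1 i' j').+1.
Proof.
move=> im' jn jn'; rewrite /lower_dist (odd_last n hn nev).
case: (ltngtP j' j) => [lt|lt|e].
- have bt : snake_dist m 1 j i' j' <= snake_dist m 1 n.-1 i' j'.
    by apply: snake_dist_last; lia.
  by case_ifs; lia.
- rewrite /blocked /snake_dist (odd_last n hn nev). set x := _ * m.-1.
  by case oj: (odd j); case oj': (odd j') => /=; case_ifs; lia.
- subst j'; rewrite /snake_dist (odd_last n hn nev). set x := _ * m.-1.
  by case oj: (odd j) => /=; case_ifs; lia.
Qed.

Lemma comb_dist_lip (i j k l i' j' : nat) :
  i < m -> k < m -> i' < m -> j < n -> l < n -> j' < n ->
  comb_arc m n i j k l -> comb_dist m n i j i' j' <= (comb_dist m n k l i' j').+1.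
Proof.
move=> im km im' jn ln jn' a; rewrite /comb_dist.
(* Eight cases, by which of target, tail and head lie in the top row. An arc down from the top row
   lies in the last column; an arc into it starts in row 1. *)
have [i0|i0] := posnP i'; have [ei|ip] := posnP i; have [ek|kp] := posnP k;
  rewrite ?i0 ?gtn_eqF //=.
- by move: a; rewrite /comb_arc ei ek; case_ifs; lia.
- have [-> [-> ->]] : j = n.-1 /\ k = 1 /\ l = n.-1.
    by move: a; rewrite /comb_arc ei; case: (odd j); lia.
  by rewrite /rise_dist; case_ifs; lia.
- have [-> [-> lt]] : l = j /\ i = 1 /\ j < n.-1.
    by move: a; rewrite /comb_arc ek; case: (odd j); lia.
  have bt : j' < j -> snake_dist m 1 j 1 j' <= snake_dist m 1 n.-1 1 j'.
    by move=> ?; apply: snake_dist_last; lia.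
  by rewrite /rise_dist; case_ifs; lia.
- by apply: rise_dist_lip; rewrite ?ip ?kp.
- by move: a; rewrite /comb_arc ei ek; set x := lower_dist _ _ _ _ _ _; lia.
- have [-> [-> ->]] : j = n.-1 /\ k = 1 /\ l = n.-1.
    by move: a; rewrite /comb_arc ei; case: (odd j); lia.
  by set x := lower_dist _ _ _ _ _ _; lia.
- have [-> [-> lt]] : l = j /\ i = 1 /\ j < n.-1.
    by move: a; rewrite /comb_arc ek; case: (odd j); lia.
  by apply: lower_dist_top; lia.
- by apply: lower_dist_lip; rewrite ?ip ?kp ?i0.
Qed.

Lemma comb_dist_id (i j : nat) : comb_dist m n i j i j = 0.
Proof.
by rewrite /comb_dist /lower_dist ltnn !leqnn !subnn; case: (i == 0); case: (odd j).
Qed.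
Lemma lower_dist_step (i j i' j' : nat) :
  0 < i < m -> 0 < i' < m -> j < n -> j' < n -> (i != i') || (j != j') ->
  exists k l, [/\ 0 < k < m, l < n, comb_arc m n i j k l &
                  lower_dist m n i j i' j' = (lower_dist m n k l i' j').+1].
Proof.
move=> im im' jn jn' ne.
(* [R], [L] and [V] exhibit the arc to the right, to the left, or along the column, leaving only the
   drop by one to check. *)
have R : j.+1 < n -> (if odd j then i != 1 else i != m.-1) ->
    lower_dist m n i j i' j' = (lower_dist m n i j.+1 i' j').+1 ->
    exists k l, [/\ 0 < k < m, l < n, comb_arc m n i j k l &
                    lower_dist m n i j i' j' = (lower_dist m n k l i' j').+1].
  by move=> lt h e; exists i, j.+1; split; rewrite // /comb_arc !eqxx h orbT.
have L : 0 < j -> (if odd j then i == m.-1 else i == 1) ->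
    lower_dist m n i j i' j' = (lower_dist m n i j.-1 i' j').+1 ->
    exists k l, [/\ 0 < k < m, l < n, comb_arc m n i j k l &
                    lower_dist m n i j i' j' = (lower_dist m n k l i' j').+1].
  move=> lt h e; exists i, j.-1; split=> //; first by lia.
  by rewrite /comb_arc prednK // !eqxx h orbT.
have V : (if odd j then i < m.-1 else 1 < i) ->
    lower_dist m n i j i' j' =
      (lower_dist m n (if odd j then i.+1 else i.-1) j i' j').+1 ->
    exists k l, [/\ 0 < k < m, l < n, comb_arc m n i j k l &
                    lower_dist m n i j i' j' = (lower_dist m n k l i' j').+1].
  move=> h e; exists (if odd j then i.+1 else i.-1), j; split=> //.
    by move: h; case: (odd j); lia.
  by move: h; rewrite /comb_arc; case oj: (odd j) => /= h; lia.
case: (ltngtP j' j) => [lt|lt|e].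
- have lt1 : j' <= j.-1 by lia.
  have [vert|nvert] := boolP (if odd j then i < m.-1 else 1 < i).
    apply: V => //; rewrite /lower_dist lt /snake_dist.
    by set x := (j - j').-1 * _; move: vert; case: (odd j); lia.
  apply: L; [lia|by move: nvert; case: (odd j); lia|].
  rewrite /lower_dist lt /blocked; case: ltngtP lt1 => // [lt1 _|e _].
    by apply: snake_dist_turn => //; move: nvert; case: (odd j); lia.
  have ej : j = j'.+1 by lia.
  subst j; rewrite snake_dist_next /=.
  by move: nvert => /=; case: (odd j') => /=; case_ifs; lia.
- (* Cross to the right before moving vertically: a vertical move made too
     early can end on a row that is blocked further to the right. *)
  have [ok|nok] := boolP ((if odd j then i != 1 else i != m.-1) &&
      ((j.+1 < j') || (if odd j then i' <= i else i <= i'))).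
    by apply: R; rewrite /lower_dist /blocked /=;
      case oj: (odd j) ok => /= *; case_ifs; lia.
  by apply: V; move: nok; rewrite /lower_dist /blocked /=;
    case oj: (odd j) => /= *; case_ifs; lia.
- subst j'; rewrite eqxx orbF in ne.
  have [fwd|bwd] := boolP (if odd j then i < i' else i' < i).
    by apply: V; move: fwd; rewrite /lower_dist ?ltnn; case oj: (odd j); case_ifs; lia.
  (* The right neighbour offers the turn at the top if [j] is odd, at the bottom if [j] is even. It
     is taken when this turn is no dearer, or when [j] is 0; otherwise column [j] is followed to its
     exit and left from there. *)
  have [right|left] := boolP [&& j < n.-1 & (j == 0) ||
     (if odd j then (i + i' <= 2 * m - i - i') else (2 * m - i - i' <= i + i'))].
    apply: R; [lia| by case: (odd j) bwd; lia|].
    by rewrite /lower_dist ?ltnn ltnSn ?ltnn snake_dist_next;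
      case oj: (odd j) bwd right => /= *; case_ifs; lia.
  have [vert|nvert] := boolP (if odd j then i < m.-1 else 1 < i).
    by apply: V => //; rewrite /lower_dist ?ltnn;
      case oj: (odd j) bwd left vert => /= *; case_ifs; lia.
  apply: L; [lia | by case: (odd j) nvert; lia|].
  by rewrite /lower_dist /blocked ?ltnn;
    case oj: (odd j) bwd left nvert => /= *; case_ifs; lia.
Qed.
Lemma comb_dist_step (i j i' j' : nat) :
  i < m -> i' < m -> j < n -> j' < n -> (i != i') || (j != j') ->
  exists k l, [/\ k < m, l < n, comb_arc m n i j k l &
                  comb_dist m n i j i' j' = (comb_dist m n k l i' j').+1].
Proof.
move=> im im' jn jn' ne.
have [i0|ip] := posnP i.
  have [D|R] := boolP (j == n.-1); last first.
    exists 0, j.+1; split; [lia|lia|by rewrite /comb_arc i0 !eqxx|].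
    by rewrite i0 /comb_dist /=; set x := lower_dist _ _ _ _ _ _; case_ifs; lia.
  exists 1, n.-1; split; [lia|lia| |].
    by rewrite /comb_arc i0 (eqP D) (odd_last n hn nev); lia.
  rewrite i0 in ne *; rewrite /comb_dist /=; set x := lower_dist _ _ _ _ _ _.
  by rewrite /rise_dist; case_ifs; lia.
have [i'0|i'p] := posnP i'; last first.
  have [||//|//|//|k [l [k0 ln a e]]] := @lower_dist_step i j i' j'; [lia|lia|].
  exists k, l; split=> //; first by lia.
  by rewrite /comb_dist !gtn_eqF //; lia.
(* For a target in the top row: follow the column if it leads there or toward an exit to the left;
   else cross right from an odd column to a rising one; else the column's exit has been reached and
   the arc goes left. *)
have [V|nV] := boolP (if odd j then
    ((j' < j) || (j' == j) && (j == n.-1)) && (i < m.-1)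
    || [&& i == 1, j <= j' & j < n.-1]
  else (j <= j') || (1 < i)).
  set k := if odd j && ((j' < j) || (j == n.-1)) then i.+1 else i.-1.
  exists k, j; split=> //.
  - by rewrite /k; case: (odd j) V => /= *; case_ifs; lia.
  - by rewrite /comb_arc /k; case oj: (odd j) V => /= *; case_ifs; lia.
  - rewrite i'0 /comb_dist /= !(gtn_eqF ip) /rise_dist /snake_dist /k.
    set x := (_ - _).-1 * _.
    by case oj: (odd j) V => /= *; case_ifs; lia.
have [R|nR] := boolP (odd j && (j <= j') && (j < n.-1)).
  exists i, j.+1; split=> //; first by lia.
  - by rewrite /comb_arc; case: (odd j) R nV => /= *; lia.
  rewrite i'0 /comb_dist /= !(gtn_eqF ip) /rise_dist.
  case: (ltngtP j j') R nV => [lt|lt|e].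
  + by case oj: (odd j) => /= *; case_ifs; lia.
  + by rewrite andbF.
  + by subst j'; rewrite snake_dist_next; case oj: (odd j) => /= *; case_ifs; lia.
exists i, j.-1; split=> //.
- by lia.
- by rewrite /comb_arc; case oj: (odd j) nV nR => /= *; lia.
rewrite i'0 /comb_dist /= !(gtn_eqF ip) /rise_dist.
case: (ltngtP j' j) nV nR => [lt|lt|e].
- move=> nV _; have lt1 : j' <= j.-1 by lia.
  case: ltngtP lt1 => // [lt1 _|e _].
    rewrite snake_dist_turn //; first by case: (odd j) nV => /= *; lia.
  have ej : j = j'.+1 by lia.
  subst j; rewrite /= in nV; rewrite snake_dist_next /=.
  by case oj: (odd j') nV => /= *; case_ifs; lia.
- by case oj: (odd j) => /= *; lia.
- by subst j'; case oj: (odd j) => /= *; case_ifs; lia.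
Qed.

Lemma ddist_comb (u v : vertex m n) :
  ddist (@comb m n) u v = comb_dist m n u.1 u.2 v.1 v.2.
Proof.
apply: (@ddist_potential _ _
  (fun u v : vertex m n => comb_dist m n u.1 u.2 v.1 v.2)) => {u v}.
- by move=> v; apply: comb_dist_id.
- by move=> u w v; rewrite combE //; apply: comb_dist_lip.
move=> [i j] [i' j'] ne.
have [|||||k [l [km ln a e]]] := @comb_dist_step i j i' j' => //.
  rewrite -negb_and; apply: contra ne => /andP[/eqP ? /eqP ?].
  by apply/eqP; congr pair; apply: val_inj.
by exists (Ordinal km, Ordinal ln); rewrite ?combE.
Qed.
End Distance.

(** * Elementary sums *)

Import GRing.Theory.
Local Open Scope ring_scope.

Lemma sum_ord (R : numFieldType) h : \sum_(i < h) (i%:R : R) = h%:R * (h%:R - 1) / 2.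
Proof.
elim: h => [|h IHh]; first by rewrite big_ord0 !mul0r.
by rewrite big_ord_recr /= IHh; field.
Qed.

Lemma sum_ord_rev (R : numFieldType) h : \sum_(i < h) ((h - i.+1)%N%:R : R) =
  h%:R * (h%:R - 1) / 2.
Proof.
rewrite -sum_ord (reindex_inj rev_ord_inj); apply: eq_bigr => i _ /=.
by congr _%:R; have := ltn_ord i; lia.
Qed.

Definition dist (i i' : nat) := ((i - i') + (i' - i))%N.

Lemma sum_dist (R : numFieldType) h :
  \sum_(i < h) \sum_(i' < h) ((dist i i')%:R : R) = (h%:R ^+ 3 - h%:R) / 3.
Proof.
elim: h => [|h IHh]; first by rewrite big_ord0; field.
rewrite big_ord_recr big_ord_recr /=; under eq_bigr do rewrite big_ord_recr /=.
have e (i : 'I_h) : (dist i h = (h - i.+1).+1)%N /\ (dist h i = (h - i.+1).+1)%N.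
  by rewrite /dist; have := ltn_ord i; lia.
rewrite big_split /= IHh.
under eq_bigr do rewrite (e _).1 -natr1.
under [X in _ + (X + _)]eq_bigr do rewrite (e _).2 -natr1.
rewrite /dist subnn !big_split /= sum_ord_rev sumr_const card_ord.
by field.
Qed.

(** Induction by steps of two: the two end terms equal 2, and each inner term exceeds the
    corresponding one for [h] by 2. The parity of the number of rows enters the formula here. *)
Lemma sum_min_diag (R : numFieldType) h :
  \sum_(i < h) ((minn (i + i + 2) (2 * h - i - i))%:R : R) =
  (h%:R ^+ 2 + 2 * h%:R + (odd h)%:R) / 2.
Proof.
have [k] := ubnP h; elim: k h => // k IHk [|[|h]] hk.
- by rewrite big_ord0 /=; field.
- by rewrite big_ord1 (_ : minn _ _ = 2)%N /=; [field|lia].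
rewrite big_ord_recr big_ord_recl /=.
have e (i : 'I_h) :
    (minn (bump 0 i + bump 0 i + 2) (2 * h.+2 - bump 0 i - bump 0 i) =
     (minn (i + i + 2) (2 * h - i - i)).+2)%N.
  by rewrite /bump; have := ltn_ord i; lia.
under eq_bigr do rewrite e -addn2 natrD.
rewrite big_split /= IHk; last by lia.
rewrite sumr_const card_ord negbK.
have -> : (minn (0 + 0 + 2) (2 * h.+2 - 0 - 0) = 2)%N by lia.
have -> : (minn (h.+1 + h.+1 + 2) (2 * h.+2 - h.+1 - h.+1) = 2)%N by lia.
by field.
Qed.

(* Reversing the order of i' turns the minimum into h + 1 - dist i i'. *)
Lemma sum_min (R : numFieldType) h :
  \sum_(i < h) \sum_(i' < h) ((minn (i + i' + 2) (2 * h - i - i'))%:R : R)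
   = h%:R ^+ 2 * (h%:R + 1) - (h%:R ^+ 3 - h%:R) / 3.
Proof.
have e (i i' : 'I_h) :
    (minn (i + rev_ord i' + 2) (2 * h - i - rev_ord i'))%:R =
    h.+1%:R - (dist i i')%:R :> R.
  rewrite -natrB; last by rewrite /dist; have := ltn_ord i; have := ltn_ord i'; lia.
  by congr _%:R; rewrite /dist /=; have := ltn_ord i; have := ltn_ord i'; lia.
transitivity (\sum_(i < h) \sum_(i' < h) (h.+1%:R - (dist i i')%:R : R)).
  apply: eq_bigr => i _; rewrite (reindex_inj rev_ord_inj).
  by apply: eq_bigr => i' _; exact: e.
under eq_bigr do rewrite sumrB.
rewrite sumrB sum_dist !sumr_const !card_ord.
by field.
Qed.

Lemma sum_delta (R : numFieldType) (h a : nat) (c : R) : (a < h)%N ->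
  \sum_(i < h) (if i == a :> nat then c else 0) = c.
Proof. by move=> ah; rewrite -big_mkcond (big_pred1 (Ordinal ah)). Qed.

(** * Sums over rows for fixed columns, with [H] lower rows indexed by [i.+1] *)

Section Blocks.
Variables (R : numFieldType) (H n : nat).
Hypotheses (hH : (3 <= H)%N) (hn : (3 < n)%N) (nev : ~~ odd n).
Notation h := (H%:R : R).
Notation N := (n%:R : R).

(** Exit costs run through 0 to [H - 1] in one order or the other, so the column's parity
    disappears; likewise for entry costs. *)
Lemma sum_exit (b : bool) :
  \sum_(i < H) ((if b then H - i.+1 else i)%N%:R : R) = h * (h - 1) / 2.
Proof. by case: b; [exact: sum_ord_rev | exact: sum_ord]. Qed.

Lemma sum_entry (b : bool) :
  \sum_(i < H) ((if b then i : nat else H - i.+1)%N%:R : R) = h * (h - 1) / 2.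
Proof. by case: b; [exact: sum_ord | exact: sum_ord_rev]. Qed.

Lemma natr_gap (j j' : nat) : (j' < j)%N -> (j - j').-1%:R = j%:R - j'%:R - 1 :> R.
Proof. by move=> lt; rewrite -subn1 !natrB //; lia. Qed.

(** Exit and entry cost [(h - 1) / 2] each on average; with the arc and the full columns between,
    the mean distance is [(j - j') * h]. *)
Lemma sum_lower_gt (j j' : nat) : (j' < j)%N ->
  \sum_(i < H) \sum_(i' < H) ((lower_dist H.+1 n i.+1 j i'.+1 j')%:R : R) =
  (j%:R - j'%:R) * h ^+ 3.
Proof.
move=> lt; rewrite /lower_dist lt /snake_dist /=.
under eq_bigr do under eq_bigr do rewrite !natrD natrM (natr_gap _ _ lt).
under eq_bigr do rewrite big_split /= sum_entry sumr_const card_ord.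
rewrite big_split /= sumr_const card_ord sumrMnl !big_split /= !sumr_const.
rewrite !card_ord sum_exit.
by field.
Qed.

(** Grid distances plus detours: one row is blocked between adjacent columns, two rows otherwise,
    which gives the last two terms. *)
Lemma sum_lower_lt (j j' : nat) : (j < j')%N ->
  \sum_(i < H) \sum_(i' < H) ((lower_dist H.+1 n i.+1 j i'.+1 j')%:R : R) =
  (j'%:R - j%:R) * h ^+ 2 + (h ^+ 3 - h) / 3 + 2 + (if (j.+1 < j')%N then 2 else 0).
Proof.
move=> lt; set P := ~~ odd j || (j.+1 < j')%N; set Q := odd j || (j.+1 < j')%N.
have pen (i : 'I_H) :
    \sum_(i' < H) ((if (i.+1 == i'.+1) && blocked H.+1 i.+1 j j'
                    then 2 else 0)%N%:R : R) =
    (if i == H.-1 :> nat then (if P then 2 else 0) else 0) +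
    (if i == 0%N :> nat then (if Q then 2 else 0) else 0).
  rewrite (bigD1 i) //= big1 ?addr0 => [|i' ne]; last first.
    rewrite ifF //; apply/negbTE; apply: contra ne => /andP[/eqP[ii] _].
    by apply/eqP/val_inj.
  rewrite /blocked eqxx /= -/P -/Q eqSS; have := ltn_ord i.
  have -> : (i.+1 == H) = (i == H.-1 :> nat) by lia.
  case: eqP => [e1|e1]; case: eqP => [i0|i0] /=.
  - by exfalso; lia.
  - by case: P; rewrite /= addr0.
  - by case: Q; rewrite /= add0r.
  - by rewrite addr0.
rewrite /lower_dist lt ltnNge ltnW //=.
under eq_bigr do under eq_bigr do rewrite natrD natrD subSS subSS.
under eq_bigr do rewrite !big_split /= pen sumr_const card_ord.
rewrite !big_split /= sum_dist !sum_delta ?sumr_const ?card_ord; [|lia|lia].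
rewrite natrB ?(ltnW lt) // /P /Q.
by case: (odd j); case: (j.+1 < j')%N => /=; field.
Qed.

(** By symmetry the two triangles can be swapped. Adding both versions counts [A] and [B] once off
    the diagonal and [A] twice on it. *)
Lemma sum_half (A B : nat -> nat -> R) (b : bool) :
  (forall i i', A i i' = A i' i) -> (forall i i', B i i' = B i' i) ->
  \sum_(i < H) \sum_(i' < H)
     (if (if b then i <= i' else i' <= i)%N then A i i' else B i i') =
  (\sum_(i < H) \sum_(i' < H) A i i' + \sum_(i < H) \sum_(i' < H) B i i'
   + \sum_(i < H) (A i i - B i i)) / 2.
Proof.
move=> As Bs; set X := LHS.
have X1 : X = \sum_(i < H) \sum_(i' < H) (if (i <= i')%N then A i i' else B i i').
  rewrite /X; case: (b); first by [].
  rewrite exchange_big /=; apply: eq_bigr => i _; apply: eq_bigr => i' _.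
  by rewrite (As i') (Bs i').
have X2 : X = \sum_(i < H) \sum_(i' < H) (if (i' <= i)%N then A i i' else B i i').
  rewrite X1 exchange_big /=; apply: eq_bigr => i _; apply: eq_bigr => i' _.
  by rewrite (As i') (Bs i').
have -> : X = (X + X) / 2 by field.
congr (_ / 2); rewrite {1}X1 X2 -!big_split /=; apply: eq_bigr => i _.
rewrite -!big_split /= (bigD1 i) //= [in RHS](bigD1 i) //= leqnn.
rewrite (eq_bigr (fun i' : 'I_H => A i i' + B i i')) => [|i' ne]; first by ring.
case: ltngtP => // [_|e]; first by rewrite addrC.
by case/eqP: ne; apply/val_inj.
Qed.

Lemma sum_lower_diag (j : nat) : (j < n)%N ->
  \sum_(i < H) \sum_(i' < H) ((lower_dist H.+1 n i.+1 j i'.+1 j)%:R : R) =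
  if (j == 0%N) || (j == n.-1) then 2 / 3 * (h ^+ 3 - h)
  else (h ^+ 3 - h) / 2 + (h ^+ 2 - (odd H)%:R) / 4.
Proof.
(* [B] is the cost of turning around, in shifted row indices. *)
move=> jn; pose B (i i' : nat) : nat :=
  if (j == 0%N) || (j == n.-1) then (2 * H - i - i')%N
  else minn (i + i' + 2) (2 * H - i - i').
have e (i i' : 'I_H) : (lower_dist H.+1 n i.+1 j i'.+1 j)%:R =
  if (if odd j then i <= i' else i' <= i)%N then (dist i i')%:R else (B i i')%:R :> R.
  rewrite /lower_dist !ltnn !ltnS !subSS -/(dist i i') /B.
  have -> : (2 * H.+1 - i.+1 - i'.+1 = 2 * H - i - i')%N by lia.
  have -> : (i.+1 + i'.+1 = i + i' + 2)%N by lia.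
  by case: ifP.
under eq_bigr do under eq_bigr do rewrite e.
rewrite (sum_half (fun i i' => (dist i i')%:R) (fun i i' => (B i i')%:R)).
- rewrite sum_dist sumrB /B /dist; case: ifP => _; last first.
    rewrite sum_min sum_min_diag; under eq_bigr do rewrite subnn.
    by rewrite big1 //; field.
  have eB (i i' : 'I_H) : (2 * H - i - i')%N%:R = 2 * h - i%:R - i'%:R :> R.
    by rewrite !natrB ?natrM //; have := ltn_ord i; have := ltn_ord i'; lia.
  under [X in _ + X + _]eq_bigr do under eq_bigr do rewrite eB.
  under [X in _ + X + _]eq_bigr do rewrite sumrB sum_ord sumr_const card_ord.
  under [X in _ + _ + (X - _)]eq_bigr do rewrite subnn.
  under [X in _ + _ + (_ - X)]eq_bigr do rewrite eB -addrA -opprD -mulr2n -mulr_natl.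
  rewrite !sumrB !sumrMnl !sumrB !sum_ord !sumr_const !card_ord.
  by field.
- by move=> i i'; rewrite /dist addnC.
- by move=> i i'; rewrite /B subnAC [(i + i')%N]addnC.
Qed.

Lemma sum_rise (j j' : nat) : (j < n)%N -> (j' < n)%N ->
  \sum_(i < H) ((rise_dist H.+1 n i.+1 j j')%:R : R) =
  if (j < j')%N then h * (h + 1) / 2 + (j'%:R - j%:R) * h
  else if (j' < j)%N then h * (h - 1) / 2 +
    h * (2 + (j%:R - j'%:R - 1) * h + (~~ odd j')%:R * (h - 1))
  else h * (h + 1) / 2 + (if odd j then
     if j == n.-1 then h * (h + 1) else 2 * h - 2 else 0).
Proof.
move=> jn jn'; have S1 : \sum_(i < H) (i.+1%:R : R) = h * (h + 1) / 2.
  under eq_bigr do rewrite -natr1.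
  by rewrite big_split /= sum_ord sumr_const card_ord; field.
rewrite /rise_dist; case: ltngtP => [lt|lt|e].
- under eq_bigr do rewrite natrD natrB ?(ltnW lt) //.
  by rewrite big_split /= S1 sumr_const card_ord; field.
- rewrite /snake_dist /=.
  under eq_bigr do rewrite -natr1 !natrD natrM (natr_gap _ _ lt).
  rewrite !big_split /= sum_exit !sumr_const card_ord.
  by case: (odd j'); rewrite /= ?subn1 -?subn1 ?natrB; [field|field|lia].
- case oj: (odd j); rewrite /= ?addr0 //; case: eqP => [ej|nej].
    have eB (i : 'I_H) : (2 * H.+1 - i.+1)%N%:R = 2 * h + 2 - i.+1%:R :> R.
      rewrite natrB; last by have := ltn_ord i; lia.
      by ring.
    under eq_bigr do rewrite eB.
    by rewrite sumrB S1 sumr_const card_ord; field.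
  (* Row 1 climbs directly, at cost 1 where the general expression gives 3. *)
  have eB (i : 'I_H) : (if i.+1 == 1%N then 1%N else i.+3)%:R =
      i.+1%:R + (2 - (if i == 0%N :> nat then 2 else 0)) :> R.
    by rewrite eqSS; case: eqP => [->|_]; ring.
  under eq_bigr do rewrite eB.
  rewrite big_split /= S1 sumrB sum_delta; last by lia.
  by rewrite sumr_const card_ord; field.
Qed.

Lemma sum_down (j j' : nat) : (j < n)%N -> (j' < n)%N ->
  \sum_(i < H) (((n - j) + lower_dist H.+1 n 1 n.-1 i.+1 j')%:R : R) =
  (N - j%:R) * h + h ^+ 2 * (N - 1 - j'%:R) + h * (h - 1) / 2.
Proof.
move=> jn jn'; under eq_bigr do rewrite natrD natrB ?(ltnW jn) //.
rewrite big_split /= sumr_const card_ord.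
have eN : n.-1%:R = N - 1 :> R by rewrite -subn1 natrB //; lia.
(* In the last column the target is reached by descending, at cost [i]; the snake formula
   specialises to the same sum. *)
have [e|ne] := eqVneq j' n.-1.
  rewrite /lower_dist e ltnn (odd_last n hn nev) eN.
  under eq_bigr do rewrite /= subn1 /= add0n.
  by rewrite sum_ord; field.
have lt : (j' < n.-1)%N by lia.
rewrite /lower_dist lt /snake_dist (odd_last n hn nev) /= subn1.
under eq_bigr do rewrite !natrD natrM (natr_gap _ _ lt) eN.
rewrite !big_split /= sum_entry !sumr_const card_ord -subn1 natrB; last by lia.
by field.
Qed.

Lemma natr_top_left (j j' : nat) : (j' < j)%N -> (j < n)%N ->
  ((n - j + (snake_dist H.+1 1 n.-1 1 j').+1)%:R : R) =
  N - j%:R + 1 + (N - 1 - j'%:R) * h + (~~ odd j')%:R * (h - 1).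
Proof.
move=> lt jn; have eN : n.-1%:R = N - 1 :> R by rewrite -subn1 natrB //; lia.
have lt1 : (j' < n.-1)%N by lia.
rewrite /snake_dist (odd_last n hn nev) /= natrD -natr1 !natrD natrM.
rewrite (natr_gap _ _ lt1) eN.
rewrite natrB ?(ltnW jn) // natrB; last by lia.
by case: (odd j'); rewrite /= ?natrB; [ring|ring|lia].
Qed.
End Blocks.

(** * Sums over pairs of columns *)

Lemma sum_square (R : numFieldType) n (F : nat -> nat -> R) :
  \sum_(j < n) \sum_(j' < n) F j j' =
  \sum_(j < n) (F j j + \sum_(j' < j) (F j j' + F j' j)).
Proof.
elim: n => [|n IHn]; first by rewrite !big_ord0.
rewrite big_ord_recr [RHS]big_ord_recr /= -IHn.
under eq_bigr do rewrite big_ord_recr /=.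
by rewrite !big_split big_ord_recr /=; ring.
Qed.

(** [uphalf j] counts the even numbers below [j]. The term [j == 0] corrects the count [j - 1] of
    non-adjacent columns when there are none. *)
Lemma sum_below (R : numFieldType) (a b c : R) j :
  \sum_(j' < j) (a + b * j'%:R + c * (~~ odd j')%:R
                 + (if (j'.+1 < j)%N then 2 else 0)) =
  a * j%:R + b * (j%:R * (j%:R - 1) / 2) + c * (uphalf j)%:R
  + 2 * (j%:R - 1 + (j == 0%N)%:R).
Proof.
have odds k : \sum_(j' < k) ((~~ odd j')%:R : R) = (uphalf k)%:R.
  elim: k => [|k IHk]; first by rewrite big_ord0.
  by rewrite big_ord_recr /= IHk -natrD; congr _%:R; lia.
have adj : \sum_(j' < j) (if (j'.+1 < j)%N then 2 else 0 : R) =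
    2 * (j%:R - 1 + (j == 0%N)%:R).
  case: j => [|k]; first by rewrite big_ord0 /=; ring.
  rewrite big_ord_recr /= ltnn addr0 (eq_bigr (fun=> 2)) => [|i _].
    by rewrite sumr_const card_ord /=; ring.
  by rewrite ltnS ltn_ord.
rewrite !big_split /= adj -!mulr_sumr odds sum_ord sumr_const card_ord.
by ring.
Qed.

Lemma sum_quad (R : numFieldType) (a b c e f : R) p :
  \sum_(j < p.*2) (a + b * j%:R + c * j%:R ^+ 2 + e * (odd j)%:R
                   + f * (uphalf j)%:R) =
  a * (2 * p%:R) + b * (p%:R * (2 * p%:R - 1))
  + c * ((2 * p%:R - 1) * p%:R * (4 * p%:R - 1) / 3)
  + e * p%:R + f * p%:R ^+ 2.
Proof.
elim: p => [|p IHp]; first by rewrite big_ord0; field.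
rewrite doubleS !big_ord_recr /= IHp odd_double /= doubleK uphalf_double -!muln2.
by field.
Qed.

Section ColumnSums.
Variables (H n : nat).
Hypotheses (hH : (3 <= H)%N) (hn : (3 < n)%N) (nev : ~~ odd n).
Notation h := (H%:R : rat).
Notation N := (n%:R : rat).

(** All distances from column [j] to column [j'], split as top to top, top to lower, lower to top,
    lower to lower. *)
Definition column_sum (j j' : nat) : nat :=
  (comb_dist H.+1 n 0 j 0 j'
   + \sum_(i < H) ((n - j) + lower_dist H.+1 n 1 n.-1 i.+1 j')
   + (\sum_(i < H) rise_dist H.+1 n i.+1 j j'
      + \sum_(i < H) \sum_(i' < H) lower_dist H.+1 n i.+1 j i'.+1 j'))%N.

Lemma wiener_columns :
  wiener (@comb H.+1 n) = (\sum_(j < n) \sum_(j' < n) column_sum j j')%N.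
Proof.
rewrite /wiener; under eq_bigr do rewrite ddist_comb //.
rewrite -(pair_bigA _ (fun u v : vertex H.+1 n =>
  comb_dist H.+1 n u.1 u.2 v.1 v.2)) /=.
rewrite -(pair_bigA _ (fun (i : 'I_H.+1) (j : 'I_n) =>
  \sum_(v : vertex H.+1 n) comb_dist H.+1 n i j v.1 v.2)%N) /=.
rewrite exchange_big /=; apply: eq_bigr => j _.
transitivity (\sum_(i < H.+1) \sum_(j' < n) \sum_(i' < H.+1)
                comb_dist H.+1 n i j i' j')%N.
  apply: eq_bigr => i _; rewrite exchange_big /=.
  by rewrite -(pair_bigA _ (fun (i' : 'I_H.+1) (j' : 'I_n) =>
    comb_dist H.+1 n i j i' j')).
rewrite exchange_big /=; apply: eq_bigr => j' _.
rewrite big_ord_recl /= big_ord_recl /= /column_sum; congr (_ + _ + _)%N.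
by rewrite -big_split /=; apply: eq_bigr => i _; rewrite big_ord_recl.
Qed.

(** Both directions are taken together and arranged in the shape summed by [sum_below]. *)
Lemma column_sum_lt j j' : (j' < j < n)%N ->
  (column_sum j j' + column_sum j' j)%:R =
   (h ^+ 3 + h ^+ 2) * j%:R
   + ((h ^+ 3 - h) / 3 + 2 + 2 * h + 2 * N * h + 2 * h ^+ 2 * (N - 1)
      + h * (h - 1) + N + 1 + (N - 1) * h)
   + - (h + 1) ^+ 3 * j'%:R + (h - 1) * (h + 1) * (~~ odd j')%:R
   + (if (j'.+1 < j)%N then 2 else 0) :> rat.
Proof.
case/andP=> lt jn; have jn' : (j' < n)%N by exact: ltn_trans jn.
rewrite /column_sum /comb_dist /= [in (j <= j')%N]leqNgt lt (ltnW lt) /=.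
rewrite !natrD !natr_sum.
under [X in _ + (_ + X) + _]eq_bigr do rewrite natr_sum.
under [X in _ + (_ + (_ + X))]eq_bigr do rewrite natr_sum.
rewrite sum_lower_gt // sum_lower_lt // !sum_rise // !sum_down //.
rewrite -natrD natr_top_left //.
rewrite lt [(j < j')%N]ltnNge ltnW //= natrB ?(ltnW lt) //.
by case: (odd j'); case: (j'.+1 < j)%N => /=; field.
Qed.

Definition inner_column_sum : rat := (h ^+ 3 - h) / 2 + (h ^+ 2 - (odd H)%:R) / 4.

(** The end columns appear as corrections to the inner value, so that the rest is uniform in [j]. *)
Lemma column_sum_diag j : (j < n)%N ->
  (column_sum j j)%:R = inner_column_sum
   + (if j == 0%N then 2 / 3 * (h ^+ 3 - h) - inner_column_sum else 0)
   + (if j == n.-1 then 2 / 3 * (h ^+ 3 - h) - inner_column_sum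
                        + h * (h + 1) - (2 * h - 2) else 0)
   + h * (h + 1) / 2 + (2 * h - 2) * (odd j)%:R
   + (N - j%:R) * h + h ^+ 2 * (N - 1 - j%:R) + h * (h - 1) / 2 :> rat.
Proof.
move=> jn; rewrite /inner_column_sum /column_sum /comb_dist /= leqnn subnn.
rewrite !natrD !natr_sum.
under [X in _ + (_ + X)]eq_bigr do rewrite natr_sum.
rewrite sum_lower_diag // !sum_rise // !sum_down // ltnn.
have ol := odd_last n hn nev.
case: (eqVneq j 0%N) => [->|j0] /=; case: (eqVneq _ n.-1) => [e|ne] /=.
- by exfalso; lia.
- by field.
- by rewrite e ol /=; field.
- by case: (odd j) => /=; field.
Qed.
End ColumnSums.

Theorem theorem1 (m n : nat) (hm : (4 <= m)%N) (hn : (4 <= n)%N)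
    (n_even : ~~ odd n) :
  let M : rat := m%:R in
  let N : rat := n%:R in
  let beta : rat := if odd m then 3 * N - 6 else 0 in
  (wiener (@comb m n))%:R =
    1 / 12 *
    (2 * M ^+ 3 * N ^+ 3 + 2 * M ^+ 3 * N ^+ 2 + 2 * M ^+ 3 * N + 4 * M ^+ 3
     + 4 * M ^+ 2 * N ^+ 3 - 3 * M ^+ 2 * N ^+ 2 - M ^+ 2 * N - 6 * M ^+ 2
     - 2 * M * N ^+ 3 + 4 * M * N ^+ 2 - 2 * M * N - 16 * M
     + 24 * N ^+ 2 - 72 * N + 72 + beta) :> rat.
Proof.
case: m hm => // H hH M N beta; have n_gt0 : (0 < n)%N by lia.
have [p en] : exists p, n = p.*2 by exists n./2; rewrite even_halfK.
rewrite wiener_columns // natr_sum; under eq_bigr do rewrite natr_sum.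
rewrite (sum_square rat n (fun j j' => (column_sum H n j j')%:R)).
pose h : rat := H%:R.
pose mid := inner_column_sum H.
pose cst := (h ^+ 3 - h) / 3 + 2 + 2 * h + 2 * N * h + 2 * h ^+ 2 * (N - 1)
      + h * (h - 1) + N + 1 + (N - 1) * h.
(* [a], [b], [c] collect the coefficients of 1, [j] and [j ^ 2]; [d0] and [d1] are the end column
   corrections. The terms -2 in [a], 2 in [b] and 2 in [d0] come from the non-adjacent pairs in
   [sum_below]. *)
pose a := mid + h * (h + 1) / 2 + N * h + h ^+ 2 * (N - 1) + h * (h - 1) / 2 - 2.
pose b := cst - h - h ^+ 2 + (h + 1) ^+ 3 / 2 + 2.
pose c := h ^+ 3 + h ^+ 2 - (h + 1) ^+ 3 / 2.
pose d0 := 2 / 3 * (h ^+ 3 - h) - mid + 2.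
pose d1 := 2 / 3 * (h ^+ 3 - h) - mid + h * (h + 1) - (2 * h - 2).
have G (j : 'I_n) : (column_sum H n j j)%:R
    + \sum_(j' < j) ((column_sum H n j j')%:R + (column_sum H n j' j)%:R) =
  a + b * j%:R + c * j%:R ^+ 2 + (2 * h - 2) * (odd j)%:R
  + (h - 1) * (h + 1) * (uphalf j)%:R
  + (if j == 0%N :> nat then d0 else 0)
  + (if j == n.-1 :> nat then d1 else 0).
  under eq_bigr => j' _ do rewrite -natrD column_sum_lt ?ltn_ord //.
  rewrite sum_below column_sum_diag // -/h -/N -/cst -/mid /a /b /c /d0 /d1.
  by case: (_ == 0%N); case: (_ == n.-1) => /=; field.
under eq_bigr do rewrite G.
rewrite !big_split /= !sum_delta ?prednK // -!big_split /=.
have := sum_quad rat a b c (2 * h - 2) ((h - 1) * (h + 1)) p; rewrite -en => ->.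
have -> : M = h + 1 by rewrite /M -natr1.
have eN : N = 2 * p%:R by rewrite /N en -muln2 natrM mulrC.
rewrite /beta /= /a /b /c /d0 /d1 /cst /mid /inner_column_sum -/h eN.
(* Here [m] is [H.+1], so [beta] is nonzero in the branch where [H] is even. *)
by case: (odd H) => /=; field.
Qed.
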